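(* Let $Q(z)\in 1+z\mathbb{C}[[z]]$ be a power series. Let $b_n=b_n(Q)$, $n\ge1$, be the unique sequence of complex numbers such that $$\log Q(z) = -\sum_{n=1}^{\infty} b_n\log(1-z^n).$$ Then the following hold: (i) Write $\log Q(z)=\sum_{n\ge1} q_nz^n$. Then $b_1=q_1$, and for $n>1$ the sequence is given by the recursive formula $$b_n = q_n-\sum_{\substack{d\mid n\\ d>1}}\frac1d\, b_{n/d}.$$ (ii) If $Q(z)\in 1+z\mathbb{Z}[[z]]$, then $b_n\in\mathbb{Z}$ for all $n$.
   Context: All identities are between formal power series: $\log Q(z)\in z\mathbb{C}[[z]]$ is the formal logarithm, $-\log(1-z^n)=\sum_{k\ge1}z^{kn}/k$, and the infinite sum converges in the $z$-adic sense (each coefficient is a finite sum). The existence and uniqueness of the sequence $b_n$ is known. *)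

(* Defs.v *)
From HB Require Import structures.
From mathcomp Require Import all_boot all_order all_algebra.
From mathcomp Require Import boolp reals complex.

Set Implicit Arguments.
Unset Strict Implicit.
Unset Printing Implicit Defensive.

Import Order.TTheory GRing.Theory Num.Theory.
Local Open Scope ring_scope.

(* Formal power series, with the Cauchy product: a record, because the bare   *)
(* type nat -> R would carry the pointwise product.                           *)
Record fps (R : Type) := FPS { fpscoef : nat -> R }.

Notation "{ 'fps' R }" := (fps R) (format "{ 'fps'  R }") : type_scope.
(* [z^n] f *)
Notation "f `[ n ]" := (fpscoef f n)
  (at level 2, left associativity, format "f `[ n ]") : ring_scope.

HB.instance Definition _ (R : Type) := gen_eqMixin {fps R}.
HB.instance Definition _ (R : Type) := gen_choiceMixin {fps R}.

Lemma fpsP (R : Type) (f g : {fps R}) : (forall n, f`[n] = g`[n]) -> f = g.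
Proof. by case: f g => f [g] /= fg; congr FPS; apply/funext. Qed.

Section FpsRing.
Variable R : comNzRingType.
Implicit Types f g h : {fps R}.

Definition fps_zero : {fps R} := FPS (fun=> 0).
Definition fps_opp f : {fps R} := FPS (fun n => - f`[n]).
Definition fps_add f g : {fps R} := FPS (fun n => f`[n] + g`[n]).
Definition fps_one : {fps R} := FPS (fun n => (n == 0%N)%:R).
Definition fps_mul f g : {fps R} :=
  FPS (fun n => \sum_(i < n.+1) f`[i] * g`[n - i]).
Definition fps_scale (a : R) f : {fps R} := FPS (fun n => a * f`[n]).

Fact fps_addA : associative fps_add.
Proof. by move=> f g h; apply: fpsP => n /=; rewrite addrA. Qed.
Fact fps_addC : commutative fps_add.
Proof. by move=> f g; apply: fpsP => n /=; rewrite addrC. Qed.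
Fact fps_add0 : left_id fps_zero fps_add.
Proof. by move=> f; apply: fpsP => n /=; rewrite add0r. Qed.
Fact fps_addN : left_inverse fps_zero fps_opp fps_add.
Proof. by move=> f; apply: fpsP => n /=; rewrite addNr. Qed.

HB.instance Definition _ := GRing.isZmodule.Build {fps R}
  fps_addA fps_addC fps_add0 fps_addN.

Let trunc N f : {poly R} := \poly_(i < N) f`[i].

Let fps_mulE N f g n : (n < N)%N ->
  (fps_mul f g)`[n] = (trunc N f * trunc N g)`_n.
Proof.
move=> ltnN; rewrite coefM /=; apply: eq_bigr => i _; rewrite !coef_poly.
by rewrite (leq_ltn_trans _ ltnN) ?leq_ord// (leq_ltn_trans _ ltnN) ?leq_subr.
Qed.

Fact fps_mulA : associative fps_mul.
Proof.
move=> f g h; apply: fpsP => n; rewrite !(@fps_mulE n.+1)//.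
transitivity (trunc n.+1 f * trunc n.+1 g * trunc n.+1 h)`_n.
  rewrite -mulrA !coefM; apply: eq_bigr => i _; congr (_ * _).
  by rewrite coef_poly ltnS leq_subr (@fps_mulE n.+1)// ltnS leq_subr.
rewrite !(coefM _ (trunc _ h)); apply: eq_bigr => i _; congr (_ * _).
by rewrite coef_poly ltn_ord (@fps_mulE n.+1).
Qed.
Fact fps_mulC : commutative fps_mul.
Proof. by move=> f g; apply: fpsP => n; rewrite !(@fps_mulE n.+1)// mulrC. Qed.
Fact fps_mul1 : left_id fps_one fps_mul.
Proof.
move=> f; apply: fpsP => n /=; rewrite big_ord_recl /= subn0 mul1r big1 ?addr0//.
by move=> i _; rewrite mul0r.
Qed.
Fact fps_mulDl : left_distributive fps_mul fps_add.
Proof.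
move=> f g h; apply: fpsP => n /=; rewrite -big_split /=.
by apply: eq_bigr => i _; rewrite mulrDl.
Qed.
Fact fps_one_neq0 : fps_one != 0.
Proof.
by apply/eqP => /(congr1 (fun f => f`[0]))/eqP /=; rewrite oner_eq0.
Qed.

HB.instance Definition _ := GRing.Zmodule_isComNzRing.Build {fps R}
  fps_mulA fps_mulC fps_mul1 fps_mulDl fps_one_neq0.

Fact fps_scaleA a b f : fps_scale a (fps_scale b f) = fps_scale (a * b) f.
Proof. by apply: fpsP => n /=; rewrite mulrA. Qed.
Fact fps_scale1 : left_id 1 fps_scale.
Proof. by move=> f; apply: fpsP => n /=; rewrite mul1r. Qed.
Fact fps_scaleDr : right_distributive fps_scale +%R.
Proof. by move=> a f g; apply: fpsP => n /=; rewrite mulrDr. Qed.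
Fact fps_scaleDl f : {morph fps_scale^~ f : a b / a + b}.
Proof. by move=> a b; apply: fpsP => n /=; rewrite mulrDl. Qed.

HB.instance Definition _ := GRing.Zmodule_isLmodule.Build R {fps R}
  fps_scaleA fps_scale1 fps_scaleDr fps_scaleDl.

Definition fpsX : {fps R} := FPS (fun n => (n == 1%N)%:R).

(* u_N --> f in the z-adic topology. *)
Definition zadic_cvg (u : nat -> {fps R}) f :=
  forall m, exists N0, forall N, (N0 <= N)%N -> (u N)`[m] = f`[m].

Lemma fpscoefD f g n : (f + g)`[n] = f`[n] + g`[n]. Proof. by []. Qed.
Lemma fpscoefN f n : (- f)`[n] = - f`[n]. Proof. by []. Qed.
Lemma fpscoefZ a f n : (a *: f)`[n] = a * f`[n]. Proof. by []. Qed.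
Lemma fpscoefM f g n : (f * g)`[n] = \sum_(i < n.+1) f`[i] * g`[n - i].
Proof. by []. Qed.
Lemma fpscoef1 n : (1 : {fps R})`[n] = (n == 0%N)%:R. Proof. by []. Qed.
Lemma fpscoefX n : fpsX`[n] = (n == 1%N)%:R. Proof. by []. Qed.

Lemma fpscoef_sum (I : Type) (r : seq I) (P : pred I) (F : I -> {fps R}) n :
  (\sum_(i <- r | P i) F i)`[n] = \sum_(i <- r | P i) (F i)`[n].
Proof. by elim/big_rec2: _ => // i x y _ <-. Qed.

Lemma fpscoefXn k n : (fpsX ^+ k)`[n] = (n == k)%:R.
Proof.
elim: k n => [|k IHk] n //; rewrite exprSr fpscoefM.
under eq_bigr => i _ do rewrite IHk.
case: n => [|n]; first by rewrite big_ord1 subnn /= mulr0.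
rewrite big_ord_recr big_ord_recr /= subnn /= mulr0 addr0 subSnn /= mulr1.
rewrite big1 ?add0r ?eqSS// => i _.
by rewrite subSn 1?ltnW// eqSS subn_eq0 leqNgt ltn_ord /= mulr0.
Qed.

Lemma fpscoefX_small f k n : f`[0] = 0 -> (n < k)%N -> (f ^+ k)`[n] = 0.
Proof.
move=> f0; elim: k n => [//|k IHk] n; rewrite ltnS => lenk.
rewrite exprSr fpscoefM; apply: big1 => i _.
have [ltik|leki] := ltnP i k; first by rewrite IHk// mul0r.
have ->: (n - i)%N = 0%N by apply/eqP; rewrite subn_eq0 (leq_trans lenk).
by rewrite f0 mulr0.
Qed.

Lemma zadic_cvg_unique u f g : zadic_cvg u f -> zadic_cvg u g -> f = g.
Proof.
move=> uf ug; apply: fpsP => m; have [N uN] := uf m; have [M uM] := ug m.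
by rewrite -(uN _ (leq_maxl N M)) (uM _ (leq_maxr N M)).
Qed.

End FpsRing.

Arguments fpsX {R}.

Notation "''z'" := fpsX (at level 0) : ring_scope.

(* log f = - \sum_(k >= 1) (1 - f)^k / k, for f with constant coefficient 1;  *)
(* then (1 - f)^k is divisible by z^k, so only the terms k <= n contribute to *)
(* the coefficient of z^n (see fps_log_cvg).                                  *)
Definition fps_log (K : fieldType) (f : {fps K}) : {fps K} :=
  FPS (fun n => - \sum_(1 <= k < n.+1) ((1 - f) ^+ k)`[n] / k%:R).

Section FpsLog.
Variable K : fieldType.
Implicit Types f : {fps K}.

Lemma fps_log_cvg f : f`[0] = 1 ->
  zadic_cvg (fun N => - \sum_(1 <= k < N) k%:R^-1 *: (1 - f) ^+ k) (fps_log f).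
Proof.
move=> f0 m; exists m.+1 => N ltmN; rewrite fpscoefN fpscoef_sum /=; congr (- _).
rewrite (big_cat_nat _ ltmN)//=.
have ->: \sum_(m.+1 <= k < N) k%:R^-1 * ((1 - f) ^+ k)`[m] = 0.
  rewrite big_nat_cond big1// => k /andP[/andP[ltmk _] _].
  by rewrite fpscoefX_small ?mulr0// fpscoefD fpscoefN f0 fpscoef1 subrr.
by rewrite addr0; apply: eq_bigr => k _; rewrite mulrC.
Qed.

Lemma fps_log_1subXn n : (0 < n)%N ->
  zadic_cvg (fun N => \sum_(1 <= k < N) k%:R^-1 *: 'z ^+ (k * n))
    (- fps_log (1 - 'z ^+ n : {fps K})).
Proof.
move=> n0 m; have [|N0 cN] := @fps_log_cvg (1 - 'z ^+ n) _ m.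
  by case: n n0 => // n _; rewrite fpscoefD fpscoefN fpscoefXn fpscoef1 subr0.
exists N0 => N /cN; rewrite !fpscoefN => <-; rewrite opprK; congr (_`[m]).
by apply: eq_bigr => k _; rewrite subKr -exprM mulnC.
Qed.

End FpsLog.

(* Main.v *)
Require Import Defs.
From mathcomp Require Import all_boot all_order all_algebra.
From mathcomp Require Import boolp reals complex.

Import Order.TTheory GRing.Theory Num.Theory.
Local Open Scope ring_scope.

(** The logarithm turns the defining identity of the [b n] into the divisor sum
    [q_m = \sum_(n * k = m) b n / k].  Isolating its term [k = 1] gives the
    recursion (i).

    For (ii), divisions are removed by the Euler operator [theta = z d/dz],
    a derivation: its logarithmic derivative [theta f / f] sends products to
    sums, [theta_fps_log] identifies it with [theta (log f)], and for [1 - z^n]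
    it is [- \sum_(k >= 1) n z^(n k)].  Hence the logarithmic derivative of [Q]
    is the Lambert series [\sum_(d >= 1) b d * \sum_(k >= 1) d z^(d k)], which
    says that [Q] is the infinite product of the [(1 - z^d)^(- b d)].  The factors
    are peeled off one at a time: when the factors with [d < N] are gone, what
    remains is an integral series [G] equal to [1 + b N z^N] up to higher order
    terms, so [b N] is the coefficient of [z^N] in [G], an integer; then
    [G (1 - z^N)^(b N)] is again integral and continues the induction
    ([lambert_tail_integral]).  Logarithmic derivatives are written without
    division, as [theta f = f * h]. *)

(** * The Euler operator *)

Section Euler.
Set Implicit Arguments.
Unset Strict Implicit.

Variable R : comNzRingType.
Implicit Types f g h : {fps R}.

Definition theta f : {fps R} := FPS (fun n => n%:R * f`[n]).

Lemma thetaD f g : theta (f + g) = theta f + theta g.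
Proof. by apply: fpsP => n; rewrite fpscoefD /= mulrDr. Qed.

Lemma thetaN f : theta (- f) = - theta f.
Proof. by apply: fpsP => n; rewrite fpscoefN /= mulrN. Qed.

Lemma thetaZ a f : theta (a *: f) = a *: theta f.
Proof. by apply: fpsP => n; rewrite fpscoefZ /= mulrCA. Qed.

Lemma theta1 : theta 1 = 0.
Proof. by apply: fpsP => -[|n] /=; rewrite ?mul0r ?mulr0. Qed.

Lemma theta_sum (I : Type) (r : seq I) (F : I -> {fps R}) :
  theta (\sum_(i <- r) F i) = \sum_(i <- r) theta (F i).
Proof.
apply: fpsP => n; rewrite fpscoef_sum [LHS]/= fpscoef_sum mulr_sumr.
exact: eq_bigr.
Qed.

Lemma thetaM f g : theta (f * g) = theta f * g + f * theta g.
Proof.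
apply: fpsP => n; rewrite fpscoefD /= mulr_sumr -big_split /=.
apply: eq_bigr => i _; have {1}-> : n = (i + (n - i))%N.
  by rewrite subnKC // -ltnS.
by rewrite natrD mulrDl mulrA [_%:R * (f`[i] * _)]mulrCA.
Qed.

Lemma thetaXn n : theta ('z ^+ n) = n%:R *: 'z ^+ n.
Proof.
apply: fpsP => m; rewrite fpscoefZ /= fpscoefXn.
by have [->|] := eqVneq m n; rewrite ?mulr0.
Qed.

Lemma thetaX f k : theta (f ^+ k.+1) = k.+1%:R *: (f ^+ k * theta f).
Proof.
elim: k => [|k IHk]; first by rewrite expr1 expr0 mul1r scale1r.
rewrite exprS thetaM IHk -[k.+2]addn1 natrD scalerDl scale1r addrC mulrC.
by rewrite !scaler_nat mulrnAl mulrAC -exprSr [theta f * _]mulrC.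
Qed.

Lemma theta_logM f g h h' :
  theta f = f * h -> theta g = g * h' -> theta (f * g) = f * g * (h + h').
Proof.
by move=> fh gh; rewrite thetaM fh gh mulrDr mulrAC [g * h']mulrC !mulrA
  [f * h' * g]mulrAC.
Qed.

Lemma theta_logX f h k : theta f = f * h -> theta (f ^+ k) = f ^+ k * (h *+ k).
Proof.
move=> fh; elim: k => [|k IHk]; first by rewrite theta1 mulr0.
by rewrite exprS (theta_logM fh IHk) -mulrS.
Qed.

(** * z-adic limits *)

Lemma zadic_cvg_theta u f :
  zadic_cvg u f -> zadic_cvg (fun N => theta (u N)) (theta f).
Proof. by move=> uf m; have [M uM] := uf m; exists M => N /uM /= ->. Qed.

(** A coefficient of a product involves finitely many coefficients of each
    factor, so one rank serves all of them. *)
Lemma zadic_cvgMl g u f :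
  zadic_cvg u f -> zadic_cvg (fun N => g * u N) (g * f).
Proof.
move=> uf m.
have [M uM] : exists M, forall N, (M <= N)%N ->
    forall i, (i <= m)%N -> (u N)`[i] = f`[i].
  elim: m => [|m [M uM]].
    by have [M uM] := uf 0%N; exists M => N /uM ? -[].
  have [M' uM'] := uf m.+1; exists (maxn M M') => N.
  rewrite geq_max => /andP[/uM uMN /uM' uMN'] i.
  by rewrite leq_eqVlt ltnS => /orP[/eqP->|/uMN].
exists M => N /uM uN; rewrite !fpscoefM; apply: eq_bigr => i _.
by rewrite uN ?leq_subr.
Qed.

(** * The factors 1 - z^n and their inverses *)

Definition geom n : {fps R} := FPS (fun m => (n %| m)%N%:R).

(** The logarithmic derivative of [geom n], namely [n z^n / (1 - z^n)]. *)
Definition lambert n : {fps R} := n%:R *: (geom n - 1).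

Lemma fpscoef_mulXn n f m :
  ('z ^+ n * f)`[m] = if (n <= m)%N then f`[m - n] else 0.
Proof.
rewrite fpscoefM; case: leqP => [lenm|ltmn].
  have lt : (n < m.+1)%N by [].
  rewrite (bigD1 (Ordinal lt)) //= fpscoefXn eqxx mul1r big1 ?addr0 // => i.
  by rewrite -val_eqE /= fpscoefXn => /negPf->; rewrite mul0r.
apply: big1 => i _; rewrite fpscoefXn; case: eqP => [ein|]; last by rewrite mul0r.
by have := leq_trans (ltn_ord i) ltmn; rewrite ein ltnn.
Qed.

Lemma mul_geom n : (0 < n)%N -> (1 - 'z ^+ n) * geom n = 1.
Proof.
move=> n0; apply: fpsP => m.
rewrite mulrBl mul1r fpscoefD fpscoefN fpscoef_mulXn fpscoef1 /=.
have [lenm|ltmn] := leqP n m.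
  rewrite dvdn_subl ?dvdnn // subrr.
  by case: m lenm => //; rewrite leqn0; case: n n0.
rewrite subr0; case: m ltmn => [|m] ltmn; first by rewrite dvdn0.
by rewrite gtnNdvd.
Qed.

Lemma theta_1subXn n : (0 < n)%N ->
  theta (1 - 'z ^+ n) = (1 - 'z ^+ n) * - lambert n.
Proof.
move=> n0; rewrite thetaD thetaN theta1 add0r thetaXn mulrN; congr (- _).
apply/esym; rewrite /lambert.
have -> : (1 - 'z ^+ n) * (n%:R *: (geom n - 1))
    = n%:R *: ((1 - 'z ^+ n) * (geom n - 1)).
  by rewrite !scaler_nat mulrnAr.
by rewrite mulrBr mul_geom // mulr1 subKr.
Qed.

Lemma theta_geom n : (0 < n)%N -> theta (geom n) = geom n * lambert n.
Proof.
move=> n0; have e := mul_geom n0.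
have := congr1 theta e; rewrite theta1 thetaM theta_1subXn // mulrN mulNr.
rewrite mulrAC e mul1r => /eqP; rewrite addrC subr_eq0 => /eqP e2.
by rewrite -e2 mulrA [geom n * _]mulrC e mul1r.
Qed.

Lemma fpscoef_lambert n m :
  (lambert n)`[m] = (n * ((0 < m) && (n %| m)))%N%:R.
Proof.
rewrite fpscoefZ fpscoefD fpscoefN fpscoef1 /= natrM; congr (_ * _).
by case: m => [|m] /=; rewrite ?dvdn0 ?subrr ?subr0.
Qed.

End Euler.

(** * Integral power series *)

Section Integral.
Set Implicit Arguments.
Unset Strict Implicit.

Variable R : comNzRingType.

Definition integral_fps (f : {fps R}) :=
  forall n, exists a : int, f`[n] = a%:~R.

Lemma integral_fpsM f g :
  integral_fps f -> integral_fps g -> integral_fps (f * g).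
Proof.
move=> fI gI n; rewrite fpscoefM.
apply: (big_ind (fun x : R => exists a : int, x = a%:~R)).
- by exists 0.
- by move=> _ _ [a ->] [c ->]; exists (a + c); rewrite rmorphD.
move=> i _; have [a ->] := fI i; have [c ->] := gI (n - i)%N.
by exists (a * c); rewrite rmorphM.
Qed.

Lemma integral_fps1 : integral_fps 1.
Proof. by move=> n; exists (n == 0%N)%:R; rewrite fpscoef1 rmorph_nat. Qed.

Lemma integral_fpsX f k : integral_fps f -> integral_fps (f ^+ k).
Proof.
move=> fI; elim: k => [|k IHk]; first exact: integral_fps1.
by rewrite exprS; apply: integral_fpsM.
Qed.

Lemma integral_1subXn n : integral_fps (1 - 'z ^+ n).
Proof.
move=> m; exists ((m == 0%N)%:R - (m == n)%:R).
by rewrite fpscoefD fpscoefN fpscoef1 fpscoefXn rmorphB !rmorph_nat.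
Qed.

Lemma integral_geom n : integral_fps (geom R n).
Proof. by move=> m; exists (n %| m)%N%:R; rewrite rmorph_nat. Qed.

Lemma fpscoef0M (f g : {fps R}) : (f * g)`[0] = f`[0] * g`[0].
Proof. by rewrite fpscoefM big_ord1. Qed.

Lemma fpscoef0X (f : {fps R}) k : f`[0] = 1 -> (f ^+ k)`[0] = 1.
Proof.
by move=> f0; elim: k => // k IHk; rewrite exprS fpscoef0M f0 IHk mulr1.
Qed.

(** The power [(1 - z^n)^a]; a negative exponent is served by [geom n], so that
    no division of power series is involved. *)
Lemma integral_1subXn_expz n (a : int) : (0 < n)%N ->
  exists E : {fps R}, [/\ integral_fps E, E`[0] = 1 &
    theta E = E * - (a%:~R *: lambert R n)].
Proof.
move=> n0; case: a => k.
  exists ((1 - 'z ^+ n) ^+ k); split.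
  - exact/integral_fpsX/integral_1subXn.
  - apply: fpscoef0X; rewrite fpscoefD fpscoefN fpscoefXn fpscoef1.
    by case: n n0 => // n _; rewrite subr0.
  by rewrite (theta_logX k (theta_1subXn R n0)) scaler_nat mulNrn.
exists (geom R n ^+ k.+1); split.
- exact/integral_fpsX/integral_geom.
- by apply: fpscoef0X; rewrite /= dvdn0.
by rewrite (theta_logX k.+1 (theta_geom R n0)) NegzE rmorphN /= scaleNr opprK
  scaler_nat.
Qed.

End Integral.

(** * Logarithms and Lambert series *)

Section Log.
Set Implicit Arguments.
Unset Strict Implicit.

Variable K : numFieldType.
Implicit Types f : {fps K}.

(** With [u = 1 - f], applying [theta] to [- \sum_(k >= 1) u^k / k] leaves
    [- (theta u) \sum_(k >= 0) u^k], and the geometric series is [1 / f]. *)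
Lemma theta_fps_log f : f`[0] = 1 -> theta f = f * theta (fps_log f).
Proof.
move=> f0; set u := 1 - f.
have u0 : u`[0] = 0 by rewrite fpscoefD fpscoefN f0 fpscoef1 subrr.
apply: (@zadic_cvg_unique _ (fun N => f *
  theta (- \sum_(1 <= k < N) k%:R^-1 *: u ^+ k))); last first.
  exact/zadic_cvgMl/zadic_cvg_theta/fps_log_cvg.
have ef : f = - (u - 1) by rewrite opprB subKr.
have geo N : f * theta (- \sum_(1 <= k < N.+1) k%:R^-1 *: u ^+ k)
    = theta f - u ^+ N * theta f.
  have -> : theta (- \sum_(1 <= k < N.+1) k%:R^-1 *: u ^+ k)
      = (\sum_(k < N) u ^+ k) * theta f.
    rewrite thetaN theta_sum big_add1 /= big_mkord mulr_suml -sumrN.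
    apply: eq_bigr => k _; rewrite thetaZ thetaX scalerA mulVf ?pnatr_eq0 //.
    by rewrite scale1r {2}/u thetaD theta1 thetaN add0r mulrN opprK.
  by rewrite mulrA {1}ef mulNr -subrX1 mulNr mulrBl mul1r opprB.
move=> m; exists m.+2 => -[//|N] ltmN; rewrite geo fpscoefD fpscoefN.
(* [u^N] is divisible by [z^N], so the remainder vanishes up to order [m]. *)
rewrite fpscoefM big1 ?subr0 // => i _.
by rewrite fpscoefX_small ?mul0r // (leq_ltn_trans (leq_ord i)).
Qed.

Lemma fpscoef_log_1subXn n m :
  (fps_log (1 - 'z ^+ n : {fps K}))`[m]
    = - \sum_(1 <= k < m.+1) (m == n * k)%N%:R / k%:R.
Proof.
rewrite /fps_log /=; congr (- _); apply: eq_bigr => k _.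
by rewrite subKr -exprM fpscoefXn.
Qed.

Lemma sum_cofactor d m (F : nat -> K) : (0 < m)%N ->
  \sum_(1 <= k < m.+1) (m == d * k)%N%:R * F k
    = if (d %| m)%N then F (m %/ d)%N else 0.
Proof.
move=> m0; case: ifP => [dvdm|ndvdm]; last first.
  apply: big1 => k _; case: eqP => [e|]; last by rewrite mul0r.
  by rewrite e dvdn_mulr in ndvdm.
have d0 := dvdn_gt0 m0 dvdm.
rewrite (bigD1_seq (m %/ d)%N) ?iota_uniq //=; last first.
  by rewrite mem_index_iota divn_gt0 // dvdn_leq //= ltnS leq_div.
rewrite mulnC divnK // eqxx mul1r big1 ?addr0 // => k nk.
case: eqP => [e|]; last by rewrite mul0r.
by rewrite e mulKn ?eqxx in nk.
Qed.

Section DivisorSums.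
Variables (Q S : {fps K}) (b : nat -> K).
Hypothesis S_lim : zadic_cvg
  (fun N => \sum_(1 <= n < N) b n *: fps_log (1 - 'z ^+ n)) S.
Hypothesis logQ : fps_log Q = - S.

Lemma fpscoef_log_double m : (0 < m)%N ->
  (fps_log Q)`[m] = \sum_(1 <= n < m.+1) \sum_(1 <= k < m.+1)
                       b n * ((m == n * k)%N%:R / k%:R).
Proof.
move=> m0; rewrite logQ fpscoefN; have [N0 SN] := S_lim m.
rewrite -(SN (maxn N0 m.+1)) ?leq_maxl // fpscoef_sum.
under eq_bigr => n _ do rewrite fpscoefZ fpscoef_log_1subXn mulrN mulr_sumr.
rewrite sumrN opprK (big_cat_nat _ (leq_maxr N0 m.+1)) //=.
rewrite [X in _ + X]big_nat_cond [X in _ + X]big1 ?addr0 // => n.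
case/andP=> /andP[ltmn _] _; rewrite big_nat_cond big1 //.
move=> k /andP[/andP[k0 _] _]; rewrite (_ : _ == _ = false) ?mul0r ?mulr0 //.
by apply: ltn_eqF; rewrite (leq_trans ltmn) // leq_pmulr.
Qed.

Lemma fpscoef_log_divisors m : (0 < m)%N ->
  (fps_log Q)`[m] = \sum_(d <- divisors m) d%:R^-1 * b (m %/ d)%N.
Proof.
move=> m0; rewrite fpscoef_log_double // exchange_big_nat /=.
have dvdE : perm_eq (divisors m) [seq d <- index_iota 1 m.+1 | (d %| m)%N].
  apply: uniq_perm; rewrite ?divisors_uniq ?filter_uniq ?iota_uniq // => d.
  rewrite -dvdn_divisors // mem_filter mem_index_iota ltnS.
  by case dm: (d %| m)%N; rewrite //= (dvdn_gt0 m0 dm) dvdn_leq.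
rewrite (perm_big _ dvdE) big_filter [RHS]big_mkcond.
apply: eq_bigr => k _.
transitivity (\sum_(1 <= n < m.+1) (m == k * n)%N%:R * (k%:R^-1 * b n)).
  by apply: eq_bigr => n _; rewrite mulnC mulrCA [b n * _]mulrC.
exact: sum_cofactor.
Qed.

(** The logarithmic derivative of the product of the [(1 - z^d)^(- b d)] over
    [d >= N]. *)
Definition lambert_tail N : {fps K} :=
  FPS (fun m => \sum_(N <= d < m.+1 | (d %| m)%N) d%:R * b d).

Lemma theta_log_lambert : theta (fps_log Q) = lambert_tail 1.
Proof.
apply: fpsP => -[|m]; first by rewrite /= mul0r big_geq.
rewrite -[LHS]/(m.+1%:R * (fps_log Q)`[m.+1]).
rewrite fpscoef_log_double // mulr_sumr [RHS]big_mkcond.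
apply: eq_big_nat => d /andP[d0 _]; rewrite -mulr_sumr sum_cofactor //.
case: ifP => [dvdd|_]; last by rewrite !mulr0.
have q0 : (m.+1 %/ d)%N%:R != 0 :> K.
  by rewrite pnatr_eq0 -lt0n divn_gt0 // dvdn_leq.
by rewrite -{1}(divnK dvdd) natrM mulrC mulrA divfK // mulrC.
Qed.

Lemma lambert_tailS N : (0 < N)%N ->
  lambert_tail N - b N *: lambert K N = lambert_tail N.+1.
Proof.
move=> N0; apply: fpsP => m.
rewrite fpscoefD fpscoefN fpscoefZ fpscoef_lambert /=.
case: m => [|m]; first by rewrite !big_geq ?muln0 ?mulr0 ?subr0 // ltnW.
have [leNm|ltmN] := leqP N m.+1.
  rewrite [in LHS]big_mkcond [in RHS]big_mkcond big_ltn //=.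
  by case: ifP; rewrite ?muln1 ?muln0 addrAC [b N * _]mulrC ?subrr ?mul0r
    ?subr0 add0r.
by rewrite gtnNdvd // muln0 mulr0 subr0 !big_geq // ltnW.
Qed.

(** [lambert_tail N] starts with [N * b N * z^N], so comparing the coefficients
    of [z^N] in [theta G = G * lambert_tail N] gives [N * G_N = N * b N]. *)
Lemma lambert_tail_coef (G : {fps K}) N : (0 < N)%N -> G`[0] = 1 ->
  theta G = G * lambert_tail N -> G`[N] = b N.
Proof.
move=> N0 G0 /(congr1 (fun f => f`[N])); rewrite fpscoefM /= big_ord_recl /=.
rewrite G0 mul1r subn0 [X in _ + X]big1 ?addr0 => [|i _]; last first.
  by rewrite big_geq ?mulr0 //= /bump /= add1n ltn_subrL.
rewrite big_mkcond big_nat1 dvdnn => /mulfI; apply.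
by rewrite pnatr_eq0 -lt0n.
Qed.

(** [G] is [Q] times the product of the [(1 - z^d)^(b d)] over [1 <= d <= N].
    Its integrality at one stage makes the next exponent [b N.+1] an integer,
    which is what keeps the next factor integral. *)
Lemma lambert_tail_integral N : Q`[0] = 1 -> integral_fps Q ->
  exists G : {fps K}, [/\ integral_fps G, G`[0] = 1 &
    theta G = G * lambert_tail N.+1].
Proof.
move=> Q0 QI; elim: N => [|N [G [GI G0 GT]]].
  by exists Q; split; rewrite // -theta_log_lambert; apply: theta_fps_log.
have [a Ga] := GI N.+1.
have [E [EI E0 ET]] := integral_1subXn_expz K a (ltn0Sn N).
exists (G * E); split; first exact: integral_fpsM.
  by rewrite fpscoef0M G0 E0 mulr1.
rewrite (theta_logM GT ET) -Ga (lambert_tail_coef _ G0 GT) //.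
by rewrite lambert_tailS.
Qed.

End DivisorSums.
End Log.

Theorem theorem13p1 (R : realType) (Q : {fps R[i]}) (hQ : Q`[0] = 1)
    (b : nat -> R[i]) (S : {fps R[i]})
    (hS : zadic_cvg
            (fun N => \sum_(1 <= n < N) b n *: fps_log (1 - 'z ^+ n)) S)
    (hb : fps_log Q = - S) :
  (* (i) *)
  (b 1%N = (fps_log Q)`[1] /\
   forall n : nat, (1 < n)%N ->
     b n = (fps_log Q)`[n]
           - \sum_(d <- divisors n | (1 < d)%N) d%:R^-1 * b (n %/ d)%N) /\
  (* (ii) *)
  ((forall n : nat, exists a : int, Q`[n] = a%:~R) ->
   forall n : nat, (0 < n)%N -> exists a : int, b n = a%:~R).
Proof.
have rec n : (0 < n)%N -> b n = (fps_log Q)`[n]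
    - \sum_(d <- divisors n | (1 < d)%N) d%:R^-1 * b (n %/ d)%N.
  move=> n0; rewrite (fpscoef_log_divisors hS hb) //.
  rewrite (bigD1_seq 1%N) ?divisors_uniq -?dvdn_divisors ?dvd1n //=.
  rewrite invr1 mul1r divn1 [X in _ + X - _]big_seq_cond.
  rewrite [X in _ - X]big_seq_cond [X in _ + X - _](eq_bigl
    (fun d => (d \in divisors n) && (1 < d)%N)) ?addrK // => d.
  case dn: (d \in divisors n) => //=.
  by move: dn; rewrite -dvdn_divisors // => /(dvdn_gt0 n0); case: d => [|[]].
split=> [|QI [//|n] _].
  split=> [|n n1]; last by apply: rec; apply: ltnW.
  by rewrite (rec 1%N) // (_ : divisors 1 = [:: 1%N]) // big_cons big_nil subr0.
have [G [GI G0 GT]] := lambert_tail_integral hS hb n hQ QI.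
by have [a Ga] := GI n.+1; exists a; rewrite -Ga (lambert_tail_coef _ G0 GT).
Qed.
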